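(* Let $r=(r_{ij})$ and $W=(w_{ij})$ be real symmetric $n\times n$ matrices, let $a_1,\dots,a_n$ be positive real numbers, and assume $\bar v_{ij}=\frac{a_j-a_i}{a_j+a_i}\,r_{ij}$ for all $1\le i,j\le n$. Let $T_v^r:\mathbb{R}^n\to\mathbb{R}^n$ be the linear operator defined by $$(T_v^r\mathbf{y})_i=\sum_{j=1}^n\left[r_{ij}(y_i-y_j)-\bar v_{ij}(y_i+y_j)\right]w_{ij},\qquad 1\le i\le n.$$ Let $c>0$ and $X=\mathrm{diag}(ca_1,\dots,ca_n)$. Then $T_v^r$ is self-adjoint with respect to the inner product $\langle\cdot,\cdot\rangle_X$, i.e. $\langle T_v^r\mathbf{y},\mathbf{z}\rangle_X=\langle \mathbf{y},T_v^r\mathbf{z}\rangle_X$ for all $\mathbf{y},\mathbf{z}\in\mathbb{R}^n$.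
   Context: For a positive definite real $n\times n$ matrix $A$, $\langle \mathbf{y},\mathbf{z}\rangle_A:=\mathbf{y}^tA\mathbf{z}$ for $\mathbf{y},\mathbf{z}\in\mathbb{R}^n$. *)

(* Defs.v *)
From HB Require Import structures.
From mathcomp Require Import all_boot all_order all_algebra.
From mathcomp Require Import reals ring.

Set Implicit Arguments.
Unset Strict Implicit.
Unset Printing Implicit Defensive.

Import Order.TTheory GRing.Theory Num.Theory.
Local Open Scope ring_scope.

Definition innerprod (R : realType) (n : nat) (A : 'M[R]_n) (y z : 'cV[R]_n) : R :=
  (y^T *m A *m z) 0 0.

Definition posdefmx (R : realType) (n : nat) (A : 'M[R]_n) : Prop :=
  A^T = A /\ forall y : 'cV[R]_n, y != 0 -> 0 < innerprod A y y.

Definition Tvr_fun (R : realType) (n : nat) (r W v : 'M[R]_n) (y : 'cV[R]_n) :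
    'cV[R]_n :=
  \col_(i < n)
    \sum_(j < n) (r i j * (y i 0 - y j 0) - v i j * (y i 0 + y j 0)) * W i j.

Lemma Tvr_fun_is_linear (R : realType) (n : nat) (r W v : 'M[R]_n) :
  linear (Tvr_fun r W v).
Proof.
move=> k y z; apply/colP => i; rewrite !mxE mulr_sumr -big_split /=.
apply: eq_bigr => j _; rewrite !mxE; by ring.
Qed.

HB.instance Definition _ (R : realType) (n : nat) (r W v : 'M[R]_n) :=
  GRing.isLinear.Build R 'cV[R]_n 'cV[R]_n *:%R (Tvr_fun r W v)
    (Tvr_fun_is_linear r W v).

Definition Tvr (R : realType) (n : nat) (r W v : 'M[R]_n) :
  {linear 'cV[R]_n -> 'cV[R]_n} := Tvr_fun r W v.

Definition selfadjoint (R : realType) (n : nat) (A : 'M[R]_n)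
    (T : {linear 'cV[R]_n -> 'cV[R]_n}) : Prop :=
  forall y z : 'cV[R]_n, innerprod A (T y) z = innerprod A y (T z).

(* [innerprod A] is an inner product only when [posdefmx A]; this covers the
   diagonal weights with positive entries. *)
Lemma posdefmx_diag (R : realType) (n : nat) (d : 'I_n -> R) :
  (forall i, 0 < d i) -> posdefmx (diag_mx (\row_i d i)).
Proof.
move=> d_gt0; split=> [|y y_neq0]; first exact: tr_diag_mx.
have innerE : innerprod (diag_mx (\row_i d i)) y y = \sum_i d i * y i 0 ^+ 2.
  rewrite /innerprod mul_mx_diag !mxE; apply: eq_bigr => i _.
  by rewrite !mxE expr2 mulrA [d i * _]mulrC.
have term_ge0 i : 0 <= d i * y i 0 ^+ 2 by rewrite mulr_ge0 ?sqr_ge0 // ltW.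
rewrite innerE lt_neqAle sumr_ge0 // andbT eq_sym.
apply: contraNneq y_neq0 => /eqP; rewrite psumr_eq0 // => /allP sum0.
apply/eqP/colP => i; rewrite mxE; apply/eqP.
have := sum0 i (mem_index_enum i).
by rewrite /= mulf_eq0 (gt_eqF (d_gt0 i)) sqrf_eq0.
Qed.

(* Main.v *)
(** In [a_i (T y)_i], the hypothesis on [vbar] turns the [j]-th summand into
    [2 r_ij w_ij / (a_i + a_j) * (a_i^2 y_i - a_i a_j y_j)]. Hence [X T] is a
    diagonal matrix minus the matrix with entries
    [2 c r_ij w_ij a_i a_j / (a_i + a_j)], and the latter is symmetric. *)

Require Import Defs.
From HB Require Import structures.
From mathcomp Require Import all_boot all_order all_algebra.
From mathcomp Require Import reals ring.

Set Implicit Arguments.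
Unset Strict Implicit.
Unset Printing Implicit Defensive.

Import Order.TTheory GRing.Theory Num.Theory.
Local Open Scope ring_scope.

Lemma innerprod_diagE (R : realType) (n : nat) (d : 'I_n -> R)
    (y z : 'cV[R]_n) :
  innerprod (diag_mx (\row_i d i)) y z = \sum_i d i * y i 0 * z i 0.
Proof.
rewrite /innerprod mul_mx_diag !mxE; apply: eq_bigr => i _.
by rewrite !mxE [y i 0 * _]mulrC.
Qed.

(** Lets the operator be moved to the left argument, so that one expansion serves both sides of
    self-adjointness. *)
Lemma innerprodC_diag (R : realType) (n : nat) (d : 'I_n -> R)
    (y z : 'cV[R]_n) :
  innerprod (diag_mx (\row_i d i)) y z = innerprod (diag_mx (\row_i d i)) z y.
Proof. by rewrite !innerprod_diagE; apply: eq_bigr => i _; rewrite mulrAC. Qed.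

(** Rests on [(a_i + a_j)(y_i - y_j) - (a_j - a_i)(y_i + y_j) = 2 (a_i y_i - a_j y_j)], which
    separates the diagonal part from the kernel part. *)
Lemma innerprod_Tvr (R : realType) (n : nat) (r W vbar : 'M[R]_n)
    (a : 'I_n -> R) (c : R) (a_gt0 : forall i, 0 < a i)
    (vbarE : forall i j, vbar i j = (a j - a i) / (a j + a i) * r i j)
    (y z : 'cV[R]_n) (K := fun i j => 2 * c * r i j * W i j / (a i + a j)) :
  innerprod (diag_mx (\row_i (c * a i))) (Tvr r W vbar y) z =
    \sum_i \sum_j K i j * a i ^+ 2 * y i 0 * z i 0 -
    \sum_i \sum_j K i j * a i * a j * y j 0 * z i 0.
Proof.
rewrite innerprod_diagE -sumrB; apply: eq_bigr => i _.
rewrite mxE mulr_sumr mulr_suml -sumrB; apply: eq_bigr => j _.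
have a_neq0 : a i + a j != 0 by rewrite gt_eqF // addr_gt0.
by rewrite vbarE [a j + a i]addrC /K; field.
Qed.

Theorem theorem3p2 (R : realType) (n : nat) (r W vbar : 'M[R]_n)
    (a : 'I_n -> R) (c : R)
    (r_sym : r^T = r) (W_sym : W^T = W)
    (a_gt0 : forall i : 'I_n, 0 < a i)
    (vbarE : forall i j : 'I_n, vbar i j = (a j - a i) / (a j + a i) * r i j)
    (c_gt0 : 0 < c) :
  selfadjoint (diag_mx (\row_(i < n) (c * a i))) (Tvr r W vbar).
Proof.
move=> y z; rewrite [RHS]innerprodC_diag !(innerprod_Tvr _ _ a_gt0 vbarE).
congr (_ - _).
  (* Diagonal part: only the product [y_i z_i] occurs. *)
  by apply: eq_bigr => i _; apply: eq_bigr => j _; rewrite mulrAC.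
(* Kernel part: exchanging the sums swaps the roles of [i] and [j], and the kernel is symmetric
   since [r] and [W] are. *)
rewrite exchange_big /=; apply: eq_bigr => i _; apply: eq_bigr => j _.
have rC : r j i = r i j by rewrite -{1}r_sym mxE.
have WC : W j i = W i j by rewrite -{1}W_sym mxE.
by rewrite rC WC [a j + a i]addrC; ring.
Qed.
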